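(* Let $\mathcal{Y}$ be a finite set, let $\mu,\pi\in\mathcal{P}(\mathcal{Y})$ have full support with $\mu\ne\pi$, and let $K$ and $s$ be fixed positive integers with $K>2$ and $1\le s\le K$. For $M>2K$ and an outlier set $S \subset \{1,\dots,M\}$ with $|S|=s$, put $$\overline{\eta}_S(\mu\|\pi)=\min_{p\in\mathcal{P}(\mathcal{Y})}D(\mu\|p)+(M-K-|S|)\,D(\pi\|p).$$ Then, as $M\to\infty$, $$\overline{\eta}_S(\mu\|\pi)\to D(\mu\|\pi).$$ Consequently, with $\eta_S(\mu\|\pi)=\min_{p\in\mathcal{P}(\mathcal{Y})}|S|D(\mu\|p)+D(\pi\|p)$, the coefficients $\overline{\eta}_S(\mu\|\pi)$ (for $|S|=K$) and $\min(\overline{\eta}_S(\mu\|\pi),\eta_S(\mu\|\pi))$ (for $1\le|S|<K$), which give the asymptotic performance guarantee when neither $\mu$ nor $\pi$ is known, converge as $M\to\infty$ to $D(\mu\|\pi)$ and $\min(D(\mu\|\pi),\eta_S(\mu\|\pi))$ respectively, which give the guarantee when $\pi$ is known.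
   Context: $\mathcal{P}(\mathcal{Y})$ is the set of probability distributions on the finite set $\mathcal{Y}$, and $D(p\|q)=\sum_{y\in\mathcal{Y}}p(y)\log\frac{p(y)}{q(y)}$ (natural logarithm) is relative entropy. $M$ is the number of observation sequences, $K$ the maximal number of outliers ($2<K<M/2$), $S$ the outlier set, $\mu$ the outlier distribution and $\pi$ the typical distribution. The asymptotic performance guarantee of a test is the coefficient $c$ in the bound $\mathbb{E}_S[N^*]\le\frac{-\log P_{\max}}{c}(1+o(1))$ on its expected stopping time $N^*$ under hypothesis $S$ in terms of its maximal error probability $P_{\max}$. *)

(* Defs.v *)
From HB Require Import structures.
From mathcomp Require Import all_boot all_order all_algebra.
From mathcomp Require Import all_classical all_reals all_analysis.
Import Order.TTheory GRing.Theory Num.Theory.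
Import numFieldNormedType.Exports.

Set Implicit Arguments.
Unset Strict Implicit.
Unset Printing Implicit Defensive.

Local Open Scope classical_set_scope.
Local Open Scope ring_scope.
Local Open Scope ereal_scope.

Section definitions.
Context {R : realType} {Y : finType}.

Definition dist : set {ffun Y -> R} :=
  [set p | (forall y, (0 <= p y)%R) /\ (\sum_(y : Y) p y)%R = 1%R].

(* Summand p(y) log(p(y)/q(y)), with 0 log(0/q) = 0 and a log(a/0) = +oo for
   a > 0. The minima below range over all of [dist], including distributions
   without full support, so divergences are extended-real valued. *)
Definition kl_term (a b : R) : \bar R :=
  if a == 0%R then 0
  else if b == 0%R then +oo
  else (a * ln (a / b))%:E.

Definition kl (p q : {ffun Y -> R}) : \bar R :=
  \sum_(y : Y) kl_term (p y) (q y).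

(* The minima are shown to be attained in the main theorem, hence [ereal_inf].
   [etabarS] and [etaS] depend on the outlier set S only through k = |S|. *)
Definition etabarS_values (K M k : nat) (mu pi : {ffun Y -> R}) : set (\bar R) :=
  [set kl mu p + (M - K - k)%:R%:E * kl pi p | p in dist].

Definition etabarS (K M k : nat) (mu pi : {ffun Y -> R}) : \bar R :=
  ereal_inf (etabarS_values K M k mu pi).

Definition etaS_values (k : nat) (mu pi : {ffun Y -> R}) : set (\bar R) :=
  [set k%:R%:E * kl mu p + kl pi p | p in dist].

Definition etaS (k : nat) (mu pi : {ffun Y -> R}) : \bar R :=
  ereal_inf (etaS_values k mu pi).

(* Coefficient of the performance guarantee against k outliers when neither mu
   nor pi is known. *)
Definition coef_unknown (K M k : nat) (mu pi : {ffun Y -> R}) : \bar R :=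
  if k == K then etabarS K M k mu pi
  else mine (etabarS K M k mu pi) (etaS k mu pi).

(* Coefficient of the performance guarantee against k outliers when pi is
   known. *)
Definition coef_pi_known (K k : nat) (mu pi : {ffun Y -> R}) : \bar R :=
  if k == K then kl mu pi else mine (kl mu pi) (etaS k mu pi).

End definitions.

(* Main.v *)
Require Import Defs.
From HB Require Import structures.
From mathcomp Require Import all_boot all_order all_algebra.
From mathcomp Require Import all_classical all_reals all_analysis.
From mathcomp Require Import ring.
Import Order.TTheory GRing.Theory Num.Theory.
Import numFieldNormedType.Exports.
Local Open Scope classical_set_scope.
Local Open Scope ring_scope.

(** For [mu] and [pi] with full support and weights [a > 0], [b >= 0], the
    functional
    [p |-> a D(mu||p) + b D(pi||p)] is minimized by the mixture
    [m = (a mu + b pi) / (a + b)]. Indeed, for [p] with full support, the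
    compensation identity ([klr_mixture])
    [[
      a D(mu||p) + b D(pi||p) = a D(mu||m) + b D(pi||m) + (a + b) D(m||p)
    ]]
    reduces this to the nonnegativity of the divergence ([klr_ge0]), and for
    every other [p] the functional is [+oo] ([kl_eqy]). So both minima exist
    ([weighted_kl_min]).

    For [a = 1] and [b = n], the minimal value is squeezed between
    [D(mu||m_n)], as the other summand is nonnegative, and [D(mu||pi)], the
    value at [p = pi]. Since [m_n] tends pointwise to [pi] as [n] tends to
    infinity and the logarithm is continuous, [D(mu||m_n)] tends to
    [D(mu||pi)], and so does the minimum ([cvg_weighted_kl]). Continuity of the
    minimum of two extended reals gives the convergence of the coefficients. *)

Section divergence.
Set Implicit Arguments.
Unset Strict Implicit.
Context {R : realType} {Y : finType}.
Implicit Types p q mu pi : {ffun Y -> R}.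

(** The divergence as a real number, which agrees with [kl] when both arguments
    have full support. *)
Definition klr p q : R := \sum_(y : Y) p y * ln (p y / q y).

Lemma klE p q : (forall y, 0 < p y) -> (forall y, 0 < q y) ->
  kl p q = (klr p q)%:E.
Proof.
move=> p0 q0; rewrite /kl /klr -sumEFin; apply: eq_bigr => y _.
by rewrite /kl_term !gt_eqF.
Qed.

Lemma kl_eqy p q : (forall y, 0 < p y) -> (exists y, q y = 0) -> kl p q = +oo%E.
Proof.
move=> p0 [y qy0]; apply/esum_eqyP.
  by move=> i _; rewrite /kl_term (gt_eqF (p0 i)); case: ifP.
by exists y; split; rewrite ?mem_index_enum// /kl_term (gt_eqF (p0 y)) qy0 eqxx.
Qed.

Lemma klr_self p : (forall y, 0 < p y) -> klr p p = 0.
Proof.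
by move=> p0; apply: big1 => y _; rewrite divff ?gt_eqF// ln1 mulr0.
Qed.

Lemma dist_full p : dist p -> ~ (exists y, p y = 0) -> forall y, 0 < p y.
Proof.
move=> [p0 _] np y; rewrite lt_neqAle p0 andbT eq_sym; apply/eqP => py0.
by apply: np; exists y.
Qed.

(** Gibbs' inequality. *)
Lemma klr_ge0 p q : dist p -> dist q ->
  (forall y, 0 < p y) -> (forall y, 0 < q y) -> 0 <= klr p q.
Proof.
move=> [_ p1] [_ q1] p0 q0.
have <- : \sum_(y : Y) (p y - q y) = 0 by rewrite sumrB p1 q1 subrr.
apply: ler_sum => y _.
have r0 : 0 < q y / p y by rewrite divr_gt0.
(* the tangent inequality [ln r <= r - 1] at [r = q y / p y] *)
have ln_le : ln (q y / p y) <= q y / p y - 1.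
  by rewrite -{1}(subrK 1 (q y / p y)) addrC le_ln1Dx// ltrBrDl subrr.
have -> : p y / q y = (q y / p y)^-1 by rewrite invf_div.
rewrite lnV ?posrE// mulrN lerNr opprB.
apply: (le_trans (ler_wpM2l (ltW (p0 y)) ln_le)).
by rewrite mulrBr mulr1 mulrCA divff ?mulr1// gt_eqF.
Qed.

Lemma kl_ge0 p q : dist p -> dist q -> (forall y, 0 < p y) -> (0 <= kl p q)%E.
Proof.
move=> dp dq p0; have [q0|nq0] := pselect (exists y, q y = 0).
  by rewrite kl_eqy.
have {}q0 := dist_full dq nq0.
by rewrite klE// lee_fin klr_ge0.
Qed.

(** The convex combination of [mu] and [pi] with weights proportional to [a] and
    [b]. *)
Definition mixture (a b : R) mu pi : {ffun Y -> R} :=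
  [ffun y => (a * mu y + b * pi y) / (a + b)].

Section weighted_minimum.
Variables (a b : R) (mu pi : {ffun Y -> R}).
Hypotheses (a_gt0 : 0 < a) (b_ge0 : 0 <= b).
Hypotheses (mu_dist : dist mu) (pi_dist : dist pi).
Hypotheses (mu_full : forall y, 0 < mu y) (pi_full : forall y, 0 < pi y).

Let ab_gt0 : 0 < a + b. Proof. exact: ltr_wpDr. Qed.

Lemma mixture_full y : 0 < mixture a b mu pi y.
Proof.
rewrite ffunE divr_gt0// ltr_wpDr ?mulr_gt0// mulr_ge0// ltW//.
Qed.

Lemma mixture_dist : dist (mixture a b mu pi).
Proof.
split=> [y|]; first exact/ltW/mixture_full.
under eq_bigr do rewrite ffunE.
rewrite -mulr_suml big_split/= -!mulr_sumr mu_dist.2 pi_dist.2 !mulr1.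
by rewrite divff// gt_eqF.
Qed.

(** The compensation identity. *)
Lemma klr_mixture p : (forall y, 0 < p y) ->
  a * klr mu p + b * klr pi p =
  a * klr mu (mixture a b mu pi) + b * klr pi (mixture a b mu pi)
  + (a + b) * klr (mixture a b mu pi) p.
Proof.
move=> p0; rewrite /klr !mulr_sumr -!big_split/=; apply: eq_bigr => y _.
have m0 := mixture_full y.
have mE : (a + b) * mixture a b mu pi y = a * mu y + b * pi y.
  by rewrite ffunE mulrC divfK// gt_eqF.
rewrite (mulrA (a + b)) mE !ln_div ?posrE//; ring.
Qed.

Lemma weighted_kl_min p : dist p ->
  (a%:E * kl mu (mixture a b mu pi) + b%:E * kl pi (mixture a b mu pi)
   <= a%:E * kl mu p + b%:E * kl pi p)%E.
Proof.
move=> dp; have [p0|np0] := pselect (exists y, p y = 0).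
  rewrite (kl_eqy mu_full p0) gt0_muley ?lte_fin// addye ?leey//.
  by rewrite gt_eqF// (lt_le_trans (ltNyr 0))// mule_ge0 ?lee_fin// kl_ge0.
have p0 := dist_full dp np0.
rewrite !klE//; [|exact: mixture_full..].
rewrite -!EFinM -!EFinD lee_fin (klr_mixture p0) lerDl mulr_ge0 ?(ltW ab_gt0)//.
apply: klr_ge0 => //; [exact: mixture_dist|exact: mixture_full].
Qed.

Lemma ereal_inf_weighted_kl :
  ereal_inf [set (a%:E * kl mu p + b%:E * kl pi p)%E | p in dist] =
  (a%:E * kl mu (mixture a b mu pi) + b%:E * kl pi (mixture a b mu pi))%E.
Proof.
apply/eqP; rewrite eq_le; apply/andP; split.
  by apply: ereal_inf_lbound; exists (mixture a b mu pi) => //;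
    exact: mixture_dist.
by apply: le_ereal_inf_tmp => _ [p dp <-]; exact: weighted_kl_min.
Qed.

End weighted_minimum.

Lemma cvg_klr (T : Type) (F : set_system T) (FF : Filter F)
    (q_ : T -> {ffun Y -> R}) p q :
  (forall y, 0 < p y) -> (forall y, 0 < q y) ->
  (forall y, q_ t y @[t --> F] --> q y) ->
  klr p (q_ t) @[t --> F] --> klr p q.
Proof.
move=> p0 q0 q_q; rewrite /klr; apply: cvg_big => [|y _].
  exact: add_continuous.
apply: cvgMr; apply: continuous_cvg.
  by apply: continuous_ln; rewrite divr_gt0.
by apply: cvgMr; apply: cvgV => //; rewrite gt_eqF.
Qed.

Lemma cvg_mixture mu pi y :
  mixture 1 n%:R mu pi y @[n --> \oo] --> pi y.
Proof.
(* the deviation from [pi] is exactly [(mu - pi) / (n + 1)] *)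
have -> : (fun n => mixture 1 n%:R mu pi y) =
    (fun n => pi y + (mu y - pi y) * harmonic n).
  apply/funext => n; rewrite ffunE /harmonic/= -natr1 [1 + _]addrC.
  have n1 : (n%:R + 1 : R) != 0 by rewrite natr1 pnatr_eq0.
  by field.
rewrite -[X in _ --> X]addr0; apply: cvgD; first exact: cvg_cst.
by rewrite -(mulr0 (mu y - pi y)); apply: cvgMr; exact: cvg_harmonic.
Qed.

Lemma cvg_weighted_kl mu pi :
  dist mu -> dist pi -> (forall y, 0 < mu y) -> (forall y, 0 < pi y) ->
  ereal_inf [set (kl mu p + n%:R%:E * kl pi p)%E | p in dist] @[n --> \oo]
    --> kl mu pi.
Proof.
move=> mu_dist pi_dist mu_full pi_full.
have full n := @mixture_full 1 n%:R mu pi ltr01 (ler0n _ n) mu_full pi_full.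
apply: (@squeeze_cvge _ _ _ _ (fun n => kl mu (mixture 1 n%:R mu pi)) _
  (fun=> kl mu pi)); last 2 first.
- rewrite klE//.
  under eq_fun do rewrite klE//.
  apply: cvg_EFin; first by near=> n.
  by apply: cvg_klr => // y; exact: cvg_mixture.
- exact: cvg_cst.
near=> n; apply/andP; split.
  have mE := @ereal_inf_weighted_kl 1 n%:R mu pi ltr01 (ler0n _ n)
    mu_dist pi_dist mu_full pi_full.
  under eq_imagel do rewrite -[kl mu _]mul1e.
  rewrite mE mul1e leeDl// mule_ge0 ?lee_fin//.
  by apply: kl_ge0 => //; exact: mixture_dist.
apply: ereal_inf_lbound; exists pi => //.
by rewrite (klE pi_full pi_full) klr_self// mule0 adde0.
Unshelve. all: by end_near. Qed.

End divergence.

Theorem mainTheorem5 (R : realType) (Y : finType) (mu pi : {ffun Y -> R})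
    (K s : nat) (S_ : forall M : nat, {set 'I_M})
    (mu_dist : dist mu) (pi_dist : dist pi)
    (mu_full : forall y, 0 < mu y) (pi_full : forall y, 0 < pi y)
    (mu_neq_pi : mu <> pi)
    (K_gt2 : (2 < K)%N) (s_gt0 : (1 <= s)%N) (s_leK : (s <= K)%N)
    (card_S : forall M : nat, (2 * K < M)%N -> #|S_ M| = s) :
  [/\ (forall M : nat, (2 * K < M)%N ->
         etabarS_values K M #|S_ M| mu pi (etabarS K M #|S_ M| mu pi)),
      etaS_values s mu pi (etaS s mu pi),
      etabarS K M #|S_ M| mu pi @[M --> \oo] --> kl mu pi
    & coef_unknown K M #|S_ M| mu pi @[M --> \oo] --> coef_pi_known K s mu pi].
Proof.
have cvg_etabar : etabarS K M s mu pi @[M --> \oo] --> kl mu pi.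
  (* [etabarS] at [M] is the weighted minimum at [n = M - (K + s)] *)
  have := cvg_weighted_kl mu_dist pi_dist mu_full pi_full.
  rewrite -(cvg_centern (K + s)) /etabarS /etabarS_values.
  by under eq_fun do rewrite subnDA.
have S_near : \forall M \near \oo, #|S_ M| = s.
  by near=> M; apply: card_S; near: M; exact: nbhs_infty_gt.
split.
- move=> M _; rewrite /etabarS /etabarS_values.
  exists (mixture 1 (M - K - #|S_ M|)%:R mu pi).
    by apply: mixture_dist; rewrite ?ler0n.
  have := @ereal_inf_weighted_kl _ _ 1 (M - K - #|S_ M|)%:R mu pi ltr01
    (ler0n _ _) mu_dist pi_dist mu_full pi_full.
  under eq_imagel do rewrite mul1e.
  by rewrite mul1e => ->.
- rewrite /etaS /etaS_values.
  have s0 : 0 < s%:R :> R by rewrite ltr0n.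
  exists (mixture s%:R 1 mu pi); first exact: mixture_dist.
  have := @ereal_inf_weighted_kl _ _ s%:R 1 mu pi s0
    ler01 mu_dist pi_dist mu_full pi_full.
  under eq_imagel do rewrite mul1e.
  by rewrite mul1e => ->.
- apply: cvg_trans cvg_etabar; apply: near_eq_cvg.
  by near=> M; rewrite (near S_near M).
- have cvg_coef : coef_unknown K M s mu pi @[M --> \oo] -->
      coef_pi_known K s mu pi.
    rewrite /coef_unknown /coef_pi_known; case: ifP => // _.
    apply: (@continuous2_cvg _ _ _ _ _ _ _ _ (fun x y => mine x y)) => //.
    + exact: (@min_continuous _ (\bar R) (kl mu pi, etaS s mu pi)).
    + exact: cvg_cst.
  apply: cvg_trans cvg_coef; apply: near_eq_cvg.
  by near=> M; rewrite (near S_near M).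
Unshelve. all: by end_near. Qed.
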